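(* Let $\mathcal{H}$ be a hypergraph with rank $r$, and suppose $\mathcal{H}$ contains a family of $r$-uniform collars $\mathcal{C}_1,\dots,\mathcal{C}_t$ as sub-hypergraphs. For each $i\in\{1,\dots,t\}$, let $\mathbf{x}^{(i)}\in\mathbb{R}^{|E(\mathcal{H})|}$ be the vector equal to $+1$ on the odd hyperedges of $\mathcal{C}_i$, $-1$ on its even hyperedges, and $0$ elsewhere. If $\mathbf{x}^{(1)},\dots,\mathbf{x}^{(t)}$ are linearly independent, then the multiplicity $\mu$ of $-r$ as an eigenvalue of the adjacency matrix $\mathbf{A}_{\mathcal{L}}$ of the line multigraph $\mathcal{L}(\mathcal{H})$ satisfies $\mu\geq t$. In particular, if $\mathcal{H}$ contains a single $r$-uniform collar as a sub-hypergraph, then $-r$ is an eigenvalue of $\mathbf{A}_{\mathcal{L}}$.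
   Context: A hypergraph $\mathcal{H}=(V,E)$ consists of a finite set $V$ of vertices and a set $E$ of non-empty subsets of $V$, called hyperedges. The hypergraph $\mathcal{H}$ is assumed simple (no hyperedge has cardinality one and no hyperedge is contained in another) and connected (any two vertices are joined by a path, i.e. an alternating sequence of distinct vertices and hyperedges in which each hyperedge contains the vertices immediately before and after it). The rank of $\mathcal{H}$ is the largest cardinality of its hyperedges (so $E\neq\emptyset$ when the rank is mentioned). A hypergraph is $k$-uniform if all its hyperedges have cardinality $k$. The line multigraph $\mathcal{L}(\mathcal{H})$ is the multigraph with vertex set $E$ in which two distinct vertices $e,f\in E$ are joined by exactly $|e\cap f|$ edges (no loops). The adjacency matrix of a multigraph has zero diagonal, and for $u\neq v$ its $(u,v)$ entry is the number of edges joining $u$ and $v$. A sub-hypergraph $(V',E')$ of $\mathcal{H}$ satisfies $V'\subseteq V$, $E'\subseteq E$ and $e\subseteq V'$ for all $e\in E'$; sub-hypergraphs need not be connected. The degree of a vertex in a hypergraph is the number of its hyperedges containing it. A hypergraph $\mathcal{C}$ (with at least one hyperedge) is a collar if it is $2$-regular (every vertex has degree exactly $2$ in $\mathcal{C}$) and it admits an edge $2$-coloring, i.e. a map $f:E(\mathcal{C})\to\{1,2\}$ with $f(e_i)\neq f(e_j)$ for every pair of adjacent hyperedges (distinct hyperedges sharing at least one vertex). Each collar comes with a fixed such coloring $f$; a hyperedge $e$ of $\mathcal{C}$ is odd if $f(e)=1$ and even if $f(e)=2$. *)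

(* Defs.v *)
From HB Require Import structures.
From mathcomp Require Import all_boot all_order all_algebra.
From mathcomp Require Import reals.

Set Implicit Arguments.
Unset Strict Implicit.
Unset Printing Implicit Defensive.

Import Order.TTheory GRing.Theory Num.Theory.
Local Open Scope ring_scope.

(* The vertex set is a subset of an ambient finite type, so that a hypergraph
   and its sub-hypergraphs (which may drop vertices) live in the same type. *)
Record hypergraph (T : finType) := Hypergraph {
  vset : {set T};
  eset : {set {set T}};
  hypergraphP : forall e, e \in eset -> (e != set0) && (e \subset vset)
}.

Section Hypergraphs.
Variable T : finType.
Implicit Types (H C : hypergraph T) (e f : {set T}) (x y : T).

Definition simple_hypergraph H : Prop :=
  (forall e, e \in eset H -> #|e| != 1%N) /\
  (forall e f, e \in eset H -> f \in eset H -> e \subset f -> e = f).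

(* The pairs (e_1, x_1), ..., (e_k, x_k) encode the alternating sequence
   x, e_1, x_1, ..., e_k, x_k. *)
Fixpoint alternating H x (s : seq ({set T} * T)) : bool :=
  if s is (e, z) :: s' then
    [&& e \in eset H, x \in e, z \in e & alternating H z s']
  else true.

Definition is_hpath H x y (s : seq ({set T} * T)) : bool :=
  [&& alternating H x s, last x (unzip2 s) == y,
      uniq (x :: unzip2 s) & uniq (unzip1 s)].

Definition connected_hypergraph H : Prop :=
  forall x y, x \in vset H -> y \in vset H -> exists s, is_hpath H x y s.

(* Only meaningful when [eset H] is nonempty. *)
Definition hrank H : nat := (\max_(e in eset H) #|e|)%N.

Definition uniform (k : nat) H : Prop := forall e, e \in eset H -> #|e| = k.

Definition sub_hypergraph C H : bool :=
  (vset C \subset vset H) && (eset C \subset eset H).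

Definition degree H x : nat := #|[set e in eset H | x \in e]|.

Definition regular (k : nat) H : Prop :=
  forall x, x \in vset H -> degree H x = k.

Definition adjacent e f : bool := (e != f) && (e :&: f != set0).

(* The two colors are [true] (for 1) and [false] (for 2); the values of [c]
   outside [eset H] are irrelevant. *)
Definition edge_2coloring H (c : {set T} -> bool) : Prop :=
  forall e f, e \in eset H -> f \in eset H -> adjacent e f -> c e != c f.

End Hypergraphs.

Record collar (T : finType) := Collar {
  collar_hypergraph :> hypergraph T;
  collar_coloring : {set T} -> bool;
  collar_nonempty : eset collar_hypergraph != set0;
  collar_regular : regular 2 collar_hypergraph;
  collar_coloringP : edge_2coloring collar_hypergraph collar_coloring
}.

Definition odd_hyperedge (T : finType) (C : collar T) (e : {set T}) : bool :=
  (e \in eset C) && collar_coloring C e.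

Definition even_hyperedge (T : finType) (C : collar T) (e : {set T}) : bool :=
  (e \in eset C) && ~~ collar_coloring C e.

(* Loopless multigraphs, given by the number of edges joining two vertices. *)
Record multigraph (W : finType) := Multigraph {
  nb_edges : W -> W -> nat;
  nb_edges_sym : forall u v, nb_edges u v = nb_edges v u;
  nb_edges_loopless : forall u, nb_edges u u = 0%N
}.

Definition adjacency_matrix (R : nzRingType) (W : finType) (G : multigraph W) :
    'M[R]_#|W| :=
  \matrix_(i, j) (nb_edges G (enum_val i) (enum_val j))%:R.

Section LineMultigraph.
Variables (T : finType) (H : hypergraph T).

Definition hyperedge : finType := {e : {set T} | e \in eset H}.

Definition line_nb_edges (e f : hyperedge) : nat :=
  if e == f then 0%N else #|val e :&: val f|.

Fact line_nb_edges_sym e f : line_nb_edges e f = line_nb_edges f e.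
Proof. by rewrite /line_nb_edges eq_sym setIC. Qed.

Fact line_nb_edges_loopless e : line_nb_edges e e = 0%N.
Proof. by rewrite /line_nb_edges eqxx. Qed.

Definition line_multigraph : multigraph hyperedge :=
  Multigraph line_nb_edges_sym line_nb_edges_loopless.

Definition collar_vector (R : nzRingType) (C : collar T) :
    'rV[R]_#|hyperedge| :=
  \row_j (let e := val (enum_val j) in
          if odd_hyperedge C e then 1
          else if even_hyperedge C e then -1
          else 0).

End LineMultigraph.

(* The two notions coincide for real symmetric matrices, hence for adjacency
   matrices, where one simply speaks of the multiplicity of an eigenvalue. *)
Definition geometric_multiplicity (F : fieldType) (n : nat) (A : 'M[F]_n)
  (a : F) : nat := \rank (eigenspace A a).

Definition algebraic_multiplicity (F : fieldType) (n : nat) (A : 'M[F]_n)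
  (a : F) : nat := mup a (char_poly A).

(* Main.v *)
(** If [B] is the incidence matrix (vertices by hyperedges) of [H], then
    [B^T B = A + D], where [A] is the adjacency matrix of the line multigraph
    and [D] the diagonal matrix of hyperedge cardinalities. A vertex of a
    collar lies in exactly one odd and one even hyperedge of it, so [B] kills
    the collar vector; as this vector is supported on hyperedges of cardinality
    [r], it is an eigenvector of [A] for [-r]. *)

Require Import Defs.
From HB Require Import structures.
From mathcomp Require Import all_boot all_order all_algebra.
From mathcomp Require Import reals.

Set Implicit Arguments.
Unset Strict Implicit.
Unset Printing Implicit Defensive.

Import Order.TTheory GRing.Theory Num.Theory.
Local Open Scope ring_scope.

(** A basis of the eigenspace, of dimension [k], extends to an invertible matrix [P]. Then
    [('X - a%:P) ^+ k] divides [\det (P *m ('X - A))], which is [char_poly A] times the nonzero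
    constant [\det P]. *)
Lemma mup_char_poly_geq_eigenspace (F : fieldType) (n : nat) (A : 'M[F]_n)
    (a : F) :
  (\rank (eigenspace A a) <= mup a (char_poly A))%N.
Proof.
set E := eigenspace A a; set k := \rank E; set P := row_ebase E.
rewrite mup_geq ?monic_neq0 ?char_poly_monic //.
have PA (i : 'I_n) : (i < k)%N -> row i P *m A = a *: row i P.
  move=> ltik; apply/eigenspaceP; rewrite -/E.
  (* Since [E = col_ebase E *m pid_mx k *m P], the matrix on the right is [pid_mx k *m P], which
     agrees with [P] on the first [k] rows. *)
  have -> : row i P = row i (invmx (col_ebase E) *m E).
    rewrite -{2}(mulmx_ebase E) -mulmxA mulKmx ?col_ebase_unit //.
    apply/rowP=> j; rewrite !mxE (bigD1 i) //= !mxE eqxx ltik mul1r.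
    rewrite big1 ?addr0 // => l; rewrite -val_eqE /= => neq_li.
    by rewrite !mxE [_ == _ :> nat]eq_sym (negPf neq_li) mul0r.
  by rewrite row_mul submxMl.
(* The first [k] rows of [P], being eigenvectors, make the first [k] rows of
   [P *m ('X - A)] multiples of ['X - a]; [d] factors these out. *)
set Pp : 'M[{poly F}]_n := map_mx polyC P.
pose d : 'rV[{poly F}]_n := \row_i (if (i < k)%N then 'X - a%:P else 1).
pose Q : 'M[{poly F}]_n := \matrix_(i, j)
  if (i < k)%N then Pp i j else (Pp *m char_poly_mx A) i j.
have PQ : Pp *m char_poly_mx A = diag_mx d *m Q.
  apply/matrixP=> i j; rewrite mul_diag_mx [RHS]mxE [d 0 i]mxE [Q i j]mxE.
  case: ifP => ltik; last by rewrite mul1r.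
  rewrite mulmxBr mul_mx_scalar -map_mxM !mxE mulrBl -[RHS]/(_ - _).
  congr (_ - _); rewrite -polyCM; congr _%:P.
  by have /rowP/(_ j) := PA i ltik; rewrite -row_mul !mxE.
have detPQ : (\det P)%:P * char_poly A = ('X - a%:P) ^+ k * \det Q.
  have -> : ('X - a%:P) ^+ k = \det (diag_mx d).
    rewrite det_diag (eq_bigr _ (fun i _ => mxE _ _ _ i)) -big_mkcond /=.
    rewrite prodr_const; congr (_ ^+ _).
    by rewrite -[LHS]card_ord -sum1_card big_ord_narrow ?sum1_card ?rank_leq_row.
  by rewrite -det_mulmx -PQ det_mulmx det_map_mx.
have detP : \det P != 0 by rewrite -unitfE -unitmxE row_ebase_unit.
by rewrite -(dvdpZr _ _ detP) -mul_polyC detPQ dvdp_mulIl.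
Qed.

Lemma rank_geq_free_rows (F : fieldType) (m n t : nat)
    (x : 'I_t -> 'rV[F]_n) (V : 'M[F]_(m, n)) :
  free [tuple x i | i < t] -> (forall i, (x i <= V)%MS) -> (t <= \rank V)%N.
Proof.
move=> /freeP x_free xV; pose X := \matrix_i x i.
have /eqP <- : row_free X.
  apply: inj_row_free => v vX0; apply/rowP => i; rewrite mxE.
  apply: x_free => {i}; rewrite -[RHS]vX0 mulmx_sum_row.
  by apply: eq_bigr => i _; rewrite rowK -tnth_nth tnth_mktuple.
by apply/mxrankS/row_subP => i; rewrite rowK.
Qed.

Section CollarVector.
Variables (R : nzRingType) (T : finType) (H : hypergraph T) (C : collar T).
Hypothesis subCH : sub_hypergraph C H.
Implicit Types (e f : {set T}) (v : T).

(** The entries of the collar vector, extended to all subsets of [T] so that sums can range over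
    sets rather than over indices. *)
Definition collar_sign e : R :=
  if odd_hyperedge C e then 1 else if even_hyperedge C e then -1 else 0.

Lemma collar_sign_out e : e \notin eset C -> collar_sign e = 0.
Proof.
by move=> /negPf eC; rewrite /collar_sign /odd_hyperedge /even_hyperedge eC.
Qed.

Lemma collar_sign_in e : e \in eset C ->
  collar_sign e = if collar_coloring C e then 1 else -1.
Proof.
by move=> eC; rewrite /collar_sign /odd_hyperedge /even_hyperedge eC; case: collar_coloring.
Qed.

(** This is row [v] of [B x = 0]: the two hyperedges of the collar at [v] are adjacent because they
    share [v], so their signs cancel. If [v] is not a vertex of the collar, the sum is empty. *)
Lemma collar_sign_vertex v : \sum_(e in eset C | v \in e) collar_sign e = 0.
Proof.
have [vC | vC] := boolP (v \in vset C); last first.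
  rewrite big_pred0 // => e; apply/negP => /andP[/hypergraphP/andP[_]].
  by move=> /subsetP eC /eC; rewrite (negPf vC).
have /eqP/cards2P[e [f [neq_ef def_ef]]] := collar_regular vC.
have := set21 e f; have := set22 e f; rewrite -def_ef !inE.
move=> /andP[fC vf] /andP[eC ve].
have adj_ef : adjacent e f.
  by rewrite /adjacent neq_ef; apply/set0Pn; exists v; rewrite inE ve.
rewrite (eq_bigl (mem [set e; f])) => [|g]; last by rewrite -def_ef !inE.
rewrite big_setU1 ?inE //= big_set1 !collar_sign_in //.
move: (collar_coloringP eC fC adj_ef).
by case: (collar_coloring C e); case: (collar_coloring C f) => // _;
   rewrite ?subrr ?addNr.
Qed.

(** This is row [f] of [B^T B x = 0], diagonal term included. *)
Lemma collar_sign_line f :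
  \sum_(e in eset H) collar_sign e * #|e :&: f|%:R = 0.
Proof.
have [_ /subsetP sCH] := andP subCH.
rewrite (bigID (mem (eset C))) /= [X in _ + X]big1 ?addr0; last first.
  by move=> e /andP[_ eC]; rewrite collar_sign_out ?mul0r.
rewrite (eq_bigl (fun e => e \in eset C)) => [|e]; last first.
  by apply: andb_idl => /sCH.
(* Double counting: [#|e :&: f|] is the number of [v] in [f] that lie in [e]. *)
transitivity (\sum_(v in f) \sum_(e in eset C | v \in e) collar_sign e);
  last by apply: big1 => v _; apply: collar_sign_vertex.
under [RHS]eq_bigr do rewrite big_mkcondr.
rewrite exchange_big /=; apply: eq_bigr => e _.
rewrite -big_mkcondr sumr_const mulr_natr /=; congr (_ *+ _).
by apply: eq_card => v; rewrite !inE andbC.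
Qed.

Lemma collar_vector_eigen (r : nat) : uniform r C ->
  collar_vector H R C *m adjacency_matrix R (line_multigraph H)
    = - r%:R *: collar_vector H R C.
Proof.
move=> unifC; apply/rowP => i; rewrite !mxE.
set f := enum_val i; rewrite -[X in _ * X]/(collar_sign (val f)).
transitivity (\sum_(e : hyperedge H)
    collar_sign (val e) * (line_nb_edges e f)%:R).
  rewrite (reindex (@enum_val _ (mem (hyperedge H)))) /=; last first.
    by apply: onW_bij; apply: enum_val_bij.
  by apply: eq_bigr => j _; rewrite !mxE.
have := collar_sign_line (val f).
rewrite (reindex_omap (val : hyperedge H -> _) insub) /=; last first.
  by move=> e eH; rewrite insubT.
rewrite (eq_bigl xpredT) => [|e]; last by rewrite valK eqxx (valP e).
(* The two sums differ only at [e = f]: the term is [collar_sign (val f) * #|val f|] in [sum_f], but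
   zero in the adjacency sum, as there are no loops. *)
rewrite (bigD1 f) //= setIid => sum_f; rewrite (bigD1 f) //=.
rewrite {1}/line_nb_edges eqxx mulr0 add0r.
move/eqP: sum_f; rewrite addrC addr_eq0 => /eqP sum_f.
transitivity (- (collar_sign (val f) * #|val f|%:R)).
  rewrite -sum_f; apply: eq_bigr => e neq_ef.
  by rewrite /line_nb_edges (negPf neq_ef).
(* Uniformity gives [#|val f| = r] only inside the collar; outside it both sides vanish. *)
have [fC | fC] := boolP (val f \in eset C).
  by rewrite (unifC _ fC) mulNr mulr_natl mulr_natr.
by rewrite collar_sign_out // mul0r mulr0 oppr0.
Qed.

Lemma collar_vector_neq0 : collar_vector H R C != 0.
Proof.
have [e eC] := set0Pn _ (collar_nonempty C).
have eH : e \in eset H by case/andP: subCH => _ /subsetP; apply.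
apply/eqP => /rowP/(_ (enum_rank (Sub e eH : hyperedge H))).
rewrite !mxE enum_rankK /= -/(collar_sign e) collar_sign_in // => /eqP.
by case: ifP; rewrite ?oppr_eq0 oner_eq0.
Qed.

End CollarVector.

Theorem corollary4p14 (R : realType) (T : finType) (H : hypergraph T) (r : nat)
    (simpleH : simple_hypergraph H) (connectedH : connected_hypergraph H)
    (edgesH : eset H != set0) (rankH : hrank H = r) :
  (forall (t : nat) (C : 'I_t -> collar T),
     (forall i, sub_hypergraph (C i) H) ->
     (forall i, uniform r (C i)) ->
     free [tuple collar_vector H R (C i) | i < t] ->
     (t <= geometric_multiplicity
             (adjacency_matrix R (line_multigraph H)) (- r%:R))%N /\
     (t <= algebraic_multiplicity
             (adjacency_matrix R (line_multigraph H)) (- r%:R))%N)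
  /\
  (forall C : collar T, sub_hypergraph C H -> uniform r C ->
     eigenvalue (adjacency_matrix R (line_multigraph H)) (- r%:R)).
Proof.
split=> [t C subCH unifC freeC | C subCH unifC].
  set A := adjacency_matrix _ _; set a := - r%:R.
  have t_le : (t <= \rank (eigenspace A a))%N.
    apply: rank_geq_free_rows freeC _ => i.
    by apply/eigenspaceP; apply: collar_vector_eigen.
  split=> //; exact: leq_trans t_le (mup_char_poly_geq_eigenspace A a).
apply/eigenvalueP; exists (collar_vector H R C).
  exact: collar_vector_eigen.
exact: collar_vector_neq0.
Qed.
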